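(* Let $0<q<1$, $f\in C[0,1]$ and $n\ge 1$. Then for all $0\le x<1$, $$\left|R_{n,q}(f,x)-R_{\infty,q}(f,x)\right|\le \frac{2}{1-q}\,\frac{1}{1-x}\,\omega(f,q^{n}).$$
   Context: For $q>0$ and an integer $n\ge 0$: $[n]=1+q+\dots+q^{n-1}$, $[0]=0$; $[n]!=[1][2]\cdots[n]$, $[0]!=1$; for $0\le k\le n$ let ${n\brack k}=\frac{[n]!}{[k]!\,[n-k]!}$. The Lupaş $q$-analogue of the Bernstein operator is, for $f\in C[0,1]$, $x\in[0,1]$, $n\ge1$, $$R_{n,q}(f,x)=\sum_{k=0}^{n} f\!\left(\tfrac{[k]}{[n]}\right) b_{nk}(q;x),\qquad b_{nk}(q;x)={n\brack k}\frac{q^{k(k-1)/2}x^{k}(1-x)^{n-k}}{(1-x+qx)\cdots(1-x+q^{n-1}x)}.$$ For $0<q<1$ the limit $q$-Lupaş operator is $R_{\infty,q}(f,x)=\sum_{k=0}^{\infty} f(1-q^{k})\,b_{\infty k}(q;x)$ if $x\in[0,1)$ and $R_{\infty,q}(f,1)=f(1)$, where $$b_{\infty k}(q;x)=\frac{q^{k(k-1)/2}\,(x/(1-x))^{k}}{(1-q)^{k}[k]!\prod_{j=0}^{\infty}\left(1+q^{j}\,x/(1-x)\right)}.$$ The modulus of continuity is $\omega(f,t)=\sup_{|x-y|\le t}|f(x)-f(y)|$, $x,y\in[0,1]$, $t>0$. *)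

(* Defs.v *)
From HB Require Import structures.
From mathcomp Require Import all_boot all_order all_algebra.
From mathcomp Require Import all_classical all_reals all_analysis.
Import Order.TTheory GRing.Theory Num.Theory.
Import numFieldNormedType.Exports.

Set Implicit Arguments.
Unset Strict Implicit.
Unset Printing Implicit Defensive.

Local Open Scope classical_set_scope.
Local Open Scope ring_scope.

Definition qint (R : realType) (q : R) (n : nat) : R :=
  \sum_(0 <= i < n) q ^+ i.

Definition qfact (R : realType) (q : R) (n : nat) : R :=
  \prod_(1 <= i < n.+1) qint q i.

(* Meaningful only for k <= n, since n - k is truncated. *)
Definition qbinom (R : realType) (q : R) (n k : nat) : R :=
  qfact q n / (qfact q k * qfact q (n - k)).

(* The factor for j = 0 of the denominator, 1 - x + x = 1, is omitted. *)
Definition lupas_basis (R : realType) (q : R) (n k : nat) (x : R) : R :=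
  qbinom q n k * (q ^+ (k * k.-1)./2 * x ^+ k * (1 - x) ^+ (n - k))
    / \prod_(1 <= j < n) (1 - x + q ^+ j * x).

Definition lupas (R : realType) (q : R) (n : nat) (f : R -> R) (x : R) : R :=
  \sum_(0 <= k < n.+1) f (qint q k / qint q n) * lupas_basis q n k x.

Definition lim_lupas_basis (R : realType) (q : R) (k : nat) (x : R) : R :=
  q ^+ (k * k.-1)./2 * (x / (1 - x)) ^+ k
    / ((1 - q) ^+ k * qfact q k
       * limn (fun m => \prod_(0 <= j < m) (1 + q ^+ j * (x / (1 - x))))).

(* Intended for 0 < q < 1 and 0 <= x <= 1, where the limits exist when f is
   bounded on [0, 1]. *)
Definition lim_lupas (R : realType) (q : R) (f : R -> R) (x : R) : R :=
  if x == 1 then f 1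
  else limn (series (fun k => f (1 - q ^+ k) * lim_lupas_basis q k x)).

(* A supremum in R, hence the usual one when f is bounded on [0, 1] and
   0 <= t. *)
Definition modulus_continuity (R : realType) (f : R -> R) (t : R) : R :=
  sup [set z : R | exists x y : R,
    [/\ 0 <= x <= 1, 0 <= y <= 1, `|x - y| <= t & z = `|f x - f y|]].

(* Main.v *)
Require Import Defs.
From HB Require Import structures.
From mathcomp Require Import all_boot all_order all_algebra.
From mathcomp Require Import all_classical all_reals all_analysis.
From mathcomp Require Import ring lra.
Import Order.TTheory GRing.Theory Num.Theory.
Import numFieldNormedType.Exports.
Local Open Scope classical_set_scope.
Local Open Scope ring_scope.

(* Put [u = x / (1 - x)]. The numbers [b_nk(q; x)] are the distribution of
   [K_n], the sum of independent Bernoulli variables of parameters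
   [q^j u / (1 + q^j u)], [j < n], and [b_oo,k(q; x)] is that of the increasing
   limit [K_oo] of the [K_n]. As [|[k]/[n] - (1 - q^k)| <= q^n], replacing
   [f([k]/[n])] by [f(1 - q^k)] in [R_n,q] costs at most [w(f, q^n)]. Since
   [E q^K_n = (1 + q^n u) / (1 + u)], the inequality
   [|f a - f b| <= (1 + |a - b| / t) w(f, t)] with [t = q^n] gives
   [E |f(1 - q^K_n) - f(1 - q^K_oo)| <= (1 + u / (1 + u)) w(f, q^n)
   = (1 + x) w(f, q^n)].
   The total [2 + x] is at most [2 / (1 - x)]. *)

(** * Arithmetic of q-integers, q-factorials and q-binomials *)

Lemma qintS {R : realType} (q : R) n : qint q n.+1 = qint q n + q ^+ n.
Proof. by rewrite /qint big_nat_recr. Qed.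

Lemma qintD {R : realType} (q : R) m n :
  qint q (m + n) = qint q m + q ^+ m * qint q n.
Proof.
elim: n => [|n IHn].
  by rewrite addn0 /qint (big_geq (leqnn 0)) mulr0 addr0.
by rewrite addnS !qintS IHn exprD mulrDr addrA.
Qed.

Lemma mul_qint {R : realType} (q : R) n : (1 - q) * qint q n = 1 - q ^+ n.
Proof.
elim: n => [|n IHn]; first by rewrite /qint big_geq // mulr0 expr0 subrr.
by rewrite qintS mulrDr IHn exprS; ring.
Qed.

Lemma qint_ge0 {R : realType} (q : R) n : 0 <= q -> 0 <= qint q n.
Proof. by move=> q0; apply: sumr_ge0 => i _; exact: exprn_ge0. Qed.

Lemma qint_gt0 {R : realType} (q : R) n : 0 < q -> (0 < n)%N -> 0 < qint q n.
Proof.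
case: n => // n q0 _; rewrite qintS ltr_wpDl ?exprn_gt0 //.
exact/qint_ge0/ltW.
Qed.

Lemma qfact0 {R : realType} (q : R) : qfact q 0 = 1.
Proof. by rewrite /qfact big_geq. Qed.

Lemma qfactS {R : realType} (q : R) n : qfact q n.+1 = qfact q n * qint q n.+1.
Proof. by rewrite /qfact big_nat_recr. Qed.

Lemma qfact_gt0 {R : realType} (q : R) n : 0 < q -> 0 < qfact q n.
Proof.
move=> q0; elim: n => [|n IHn]; first by rewrite qfact0 ltr01.
by rewrite qfactS mulr_gt0 // qint_gt0.
Qed.

Lemma qbinom0 {R : realType} (q : R) n : 0 < q -> qbinom q n 0 = 1.
Proof.
move=> q0; rewrite /qbinom subn0 qfact0 mul1r divff //.
exact/lt0r_neq0/qfact_gt0.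
Qed.

Lemma qbinomnn {R : realType} (q : R) n : 0 < q -> qbinom q n n = 1.
Proof.
move=> q0; rewrite /qbinom subnn qfact0 mulr1 divff //.
exact/lt0r_neq0/qfact_gt0.
Qed.

(** This q-Pascal rule comes from splitting [[n + 1]] as [[n - k] + q ^+ (n - k) * [k + 1]]. It
    stops at [k < n]: for [k = n] the truncated subtraction makes [qbinom q n n.+1] nonzero. *)
Lemma qbinomS {R : realType} (q : R) n k : 0 < q -> (k < n)%N ->
  qbinom q n.+1 k.+1 = qbinom q n k.+1 + q ^+ (n - k) * qbinom q n k.
Proof.
move=> q0 kn; have {kn} -> : n = (k + (n - k.+1).+1)%N.
  by rewrite addnS -addSn subnKC.
move: (n - k.+1)%N => p.
have e1 : ((k + p.+1).+1 - k.+1 = p.+1)%N by rewrite subSS addKn.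
have e2 : (k + p.+1 - k.+1 = p)%N by rewrite addnS subSS addKn.
have e3 : (k + p.+1 - k = p.+1)%N by rewrite addKn.
rewrite /qbinom e1 e2 e3 !(qfactS q k) !(qfactS q p) (qfactS q (k + p.+1)).
have -> : qint q (k + p.+1).+1 = qint q p.+1 + q ^+ p.+1 * qint q k.+1.
  by rewrite -qintD addnC addnS.
have /lt0r_neq0 qk := qfact_gt0 q k q0.
have /lt0r_neq0 qp := qfact_gt0 q p q0.
have /lt0r_neq0 ik : 0 < qint q k.+1 by exact: qint_gt0.
have /lt0r_neq0 ip : 0 < qint q p.+1 by exact: qint_gt0.
by field; rewrite qk qp ik ip.
Qed.

Lemma expr_triangular {R : realType} (q : R) k :
  q ^+ (k.+1 * k)./2 = q ^+ (k * k.-1)./2 * q ^+ k.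
Proof. by rewrite -[k in LHS]/(k.+1.-1) -!bin2 binS bin1 exprD. Qed.

(** * Finite weights and their means *)

Definition lupas_weight {R : realType} (q u : R) (m k : nat) : R :=
  qbinom q m k * q ^+ (k * k.-1)./2 * u ^+ k.

Definition qpoch {R : realType} (q u : R) (m : nat) : R :=
  \prod_(0 <= j < m) (1 + q ^+ j * u).

(** With [u = x / (1 - x)] and [0 < m], this is the Lupaş operator with arbitrary node values [h k].
    Leaving [h] free lets one Bernoulli variable at a time be averaged out. *)
Definition lupas_mean {R : realType} (q u : R) (m : nat) (h : nat -> R) : R :=
  (\sum_(0 <= k < m.+1) lupas_weight q u m k * h k) / qpoch q u m.

Lemma lupas_weight_ge0 {R : realType} (q u : R) m k :
  0 < q -> 0 <= u -> 0 <= lupas_weight q u m k.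
Proof.
move=> q0 u0; rewrite !mulr_ge0 ?invr_ge0 ?mulr_ge0 ?exprn_ge0 ?(ltW q0) //;
  exact/ltW/qfact_gt0.
Qed.

Lemma qpochS {R : realType} (q u : R) m :
  qpoch q u m.+1 = qpoch q u m * (1 + q ^+ m * u).
Proof. by rewrite /qpoch big_nat_recr. Qed.

Lemma qpoch_factor_ge1 {R : realType} (q u : R) m :
  0 < q -> 0 <= u -> 1 <= 1 + q ^+ m * u.
Proof. by move=> q0 u0; rewrite lerDl mulr_ge0 // exprn_ge0 // ltW. Qed.

Lemma qpoch_ge1 {R : realType} (q u : R) m :
  0 < q -> 0 <= u -> 1 <= qpoch q u m.
Proof.
move=> q0 u0; elim: m => [|m IHm]; first by rewrite /qpoch big_geq.
rewrite qpochS (le_trans IHm) // ler_peMr ?qpoch_factor_ge1 //.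
exact: le_trans ler01 IHm.
Qed.

Lemma qpoch_gt0 {R : realType} (q u : R) m :
  0 < q -> 0 <= u -> 0 < qpoch q u m.
Proof. by move=> q0 u0; rewrite (lt_le_trans ltr01) ?qpoch_ge1. Qed.

(** The triangular exponent contributes [q ^+ k], which turns the [q ^+ (m - k)] of the q-Pascal
    rule into [q ^+ m]. The factor is then free of [k], which is the independence of the
    increments. *)
Lemma lupas_weightSS {R : realType} (q u : R) m k : 0 < q -> (k < m)%N ->
  lupas_weight q u m.+1 k.+1 =
  lupas_weight q u m k.+1 + q ^+ m * u * lupas_weight q u m k.
Proof.
move=> q0 km; rewrite /lupas_weight qbinomS //= expr_triangular exprS.
by rewrite -[X in q ^+ X * u](subnK (ltnW km)) exprD; ring.
Qed.

Lemma lupas_weight_sumS {R : realType} (q u : R) m (h : nat -> R) : 0 < q ->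
  \sum_(0 <= k < m.+2) lupas_weight q u m.+1 k * h k =
  \sum_(0 <= k < m.+1) lupas_weight q u m k * (h k + q ^+ m * u * h k.+1).
Proof.
(* The terms of index [0] and [m.+1] are split off, since [lupas_weightSS] covers only the indices
   from [1] to [m]. *)
move=> q0; rewrite big_nat_recl // big_nat_recr //=.
under [in RHS]eq_bigr do rewrite mulrDr.
rewrite big_split /= [in RHS]big_nat_recl // [X in _ = _ + X]big_nat_recr //=.
rewrite (eq_big_nat _ _ (F2 := fun k => lupas_weight q u m k.+1 * h k.+1
    + lupas_weight q u m k * (q ^+ m * u * h k.+1))); last first.
  by move=> k /andP[_ km]; rewrite lupas_weightSS //; ring.
rewrite big_split /= /lupas_weight !qbinom0 // !qbinomnn // expr_triangular.
by rewrite exprS; ring.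
Qed.

(** Conditioning on the last Bernoulli variable, whose odds of success are [q ^+ m * u] to 1. *)
Lemma lupas_meanS {R : realType} (q u : R) m (h : nat -> R) : 0 < q -> 0 <= u ->
  lupas_mean q u m.+1 h =
  lupas_mean q u m (fun k => (h k + q ^+ m * u * h k.+1) / (1 + q ^+ m * u)).
Proof.
move=> q0 u0; rewrite /lupas_mean lupas_weight_sumS // qpochS invfM.
under [in RHS]eq_bigr do rewrite mulrA.
by rewrite -mulr_suml -!mulrA [X in _ * X]mulrC.
Qed.

Lemma lupas_meanD {R : realType} (q u : R) m (g h : nat -> R) :
  lupas_mean q u m (fun k => g k + h k) =
  lupas_mean q u m g + lupas_mean q u m h.
Proof.
rewrite /lupas_mean -mulrDl -big_split /=; congr (_ / _).
by apply: eq_bigr => k _; rewrite mulrDr.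
Qed.

Lemma lupas_meanZ {R : realType} (q u : R) m a (h : nat -> R) :
  lupas_mean q u m (fun k => a * h k) = a * lupas_mean q u m h.
Proof.
rewrite /lupas_mean mulrA mulr_sumr; congr (_ / _).
by apply: eq_bigr => k _; rewrite mulrCA.
Qed.

Lemma lupas_meanB {R : realType} (q u : R) m (g h : nat -> R) :
  lupas_mean q u m (fun k => g k - h k) =
  lupas_mean q u m g - lupas_mean q u m h.
Proof.
rewrite lupas_meanD -mulN1r -lupas_meanZ; congr (_ + lupas_mean _ _ _ _).
by apply/funext => k; rewrite mulN1r.
Qed.

(** Each one-step average preserves constants. The case [a = 1] is the q-binomial theorem: the
    weights sum to [qpoch q u m]. *)
Lemma lupas_mean_cst {R : realType} (q u : R) m a : 0 < q -> 0 <= u ->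
  lupas_mean q u m (fun=> a) = a.
Proof.
move=> q0 u0; elim: m => [|m IHm].
  rewrite /lupas_mean /qpoch big_nat1 big_geq // /lupas_weight qbinom0 //.
  by rewrite divr1 !mul1r.
rewrite lupas_meanS // -[RHS]IHm; congr (lupas_mean _ _ _ _).
apply/funext => k; have := qpoch_factor_ge1 q u m q0 u0.
set c := _ + _ * _ => c1.
have c0 : c != 0 by rewrite gt_eqF // (lt_le_trans ltr01).
rewrite -[X in X + _]mul1r -mulrDl mulrAC divff ?mul1r //.
Qed.

(** The sequence [q ^+ k] is an eigenvector of each one-step average, with eigenvalue
    [(1 + q ^+ m.+1 * u) / (1 + q ^+ m * u)]; the product of these telescopes. *)
Lemma lupas_mean_expr {R : realType} (q u : R) m : 0 < q -> 0 <= u ->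
  lupas_mean q u m (fun k => q ^+ k) = (1 + q ^+ m * u) / (1 + u).
Proof.
move=> q0 u0; elim: m => [|m IHm].
  rewrite /lupas_mean /qpoch big_nat1 big_geq // /lupas_weight qbinom0 //.
  by rewrite !expr0 divr1 !mul1r divff // gt_eqF // ltr_pwDl.
have /lt0r_neq0 c0 : 0 < 1 + q ^+ m * u.
  by rewrite (lt_le_trans ltr01) ?qpoch_factor_ge1.
have /lt0r_neq0 u10 : 0 < 1 + u by rewrite ltr_pwDl.
rewrite lupas_meanS // (_ : (fun k : nat => _) =
  fun k => (1 + q ^+ m.+1 * u) / (1 + q ^+ m * u) * q ^+ k); last first.
  by apply/funext => k; rewrite !exprS; field.
by rewrite lupas_meanZ IHm; field; rewrite u10 c0.
Qed.

Lemma ler_lupas_mean {R : realType} (q u : R) m (g h : nat -> R) :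
  0 < q -> 0 <= u -> (forall k, (k <= m)%N -> g k <= h k) ->
  lupas_mean q u m g <= lupas_mean q u m h.
Proof.
move=> q0 u0 gh; rewrite ler_wpM2r ?invr_ge0 ?(ltW (qpoch_gt0 _ _ _ _ _)) //.
apply: ler_sum_nat => k /andP[_ km].
by rewrite ler_wpM2l ?lupas_weight_ge0 ?gh.
Qed.

Lemma ler_norm_lupas_mean {R : realType} (q u : R) m (g h : nat -> R) :
  0 < q -> 0 <= u -> (forall k, (k <= m)%N -> `|g k| <= h k) ->
  `|lupas_mean q u m g| <= lupas_mean q u m h.
Proof.
move=> q0 u0 gh; rewrite ler_norml -mulN1r -lupas_meanZ.
apply/andP; split; apply: ler_lupas_mean => // k km /=;
  by have := gh k km; rewrite ?mulN1r ler_norml => /andP[].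
Qed.

(* [lupas_mean q u m] is the expectation of a sum of independent Bernoulli
   variables of parameters [q ^+ j * u / (1 + q ^+ j * u)], [j < m]; this is
   the estimate given by the coupling in which the sums increase with [m]. *)
Lemma lupas_mean_coupling {R : realType} (q u : R) n j (g h d e : nat -> R) c :
  0 < q -> 0 <= u ->
  (forall k l, (k <= l)%N -> `|g k - h l| <= c + d k - e l) ->
  `|lupas_mean q u n g - lupas_mean q u (n + j) h|
    <= c + lupas_mean q u n d - lupas_mean q u (n + j) e.
Proof.
move=> q0 u0; elim: j h e => [|j IHj] h e ghde.
  rewrite addn0 -{1}(lupas_mean_cst q u n c) // -lupas_meanD -!lupas_meanB.
  by apply: ler_norm_lupas_mean => // k _; exact: ghde.
(* The last variable is averaged into [h] and [e], so the hypothesis must be checked for the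
   averaged sequences. It is the combination, with weights [1] and [v], of the given bounds at
   [(k, l)] and [(k, l.+1)]. *)
rewrite addnS !lupas_meanS //; apply: IHj => k l kl.
have c1 := qpoch_factor_ge1 q u (n + j) q0 u0.
have c0 : 0 < 1 + q ^+ (n + j) * u by rewrite (lt_le_trans ltr01).
rewrite -(ler_pM2r c0) -[X in _ * X <= _](gtr0_norm c0) -normrM !mulrBl.
rewrite !divfK ?gt_eqF //; set v := q ^+ (n + j) * u in c0 c1 *.
have v0 : 0 <= v by rewrite -(lerDl 1).
have h1 := ghde k l kl; have h2 := ghde k l.+1 (leqW kl).
have /(ler_wpM2l v0) {}h2 := h2.
rewrite (_ : _ - _ = (g k - h l) + v * (g k - h l.+1)); last by ring.
rewrite (le_trans (ler_normD _ _)) // normrM (ger0_norm v0).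
apply: (le_trans (lerD h1 h2)).
by rewrite le_eqVlt; apply/orP; left; apply/eqP; ring.
Qed.

(** * The infinite product and convergence to the limit weights *)

Lemma qpoch_cvg {R : realType} (q u : R) : 0 < q < 1 -> 0 <= u ->
  qpoch q u @ \oo --> limn (qpoch q u).
Proof.
move=> /andP[q0 q1] u0; apply: nondecreasing_is_cvgn.
  apply/nondecreasing_seqP => m; rewrite qpochS ler_peMr ?qpoch_factor_ge1 //.
  by rewrite ltW // qpoch_gt0.
(* Each factor satisfies [1 + a <= expR a], and the exponents sum to [u * qint q m], at most
   [u / (1 - q)]. *)
exists (expR (u / (1 - q))) => _ [m _ <-].
have q1' : 0 < 1 - q by rewrite subr_gt0.
have : qpoch q u m <= expR (u * qint q m).
  elim: m => [|m IHm]; first by rewrite /qpoch /qint !big_geq // mulr0 expR0.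
  rewrite qpochS qintS [u * _]mulrDr expRD ler_pM ?expR_ge0 //.
  - by rewrite ltW // qpoch_gt0.
  - by rewrite (le_trans ler01) ?qpoch_factor_ge1.
  - by rewrite (mulrC u) expR_ge1Dx.
move=> /le_trans; apply; rewrite ler_expR ler_wpM2l //.
rewrite -(ler_pM2l q1') mul_qint divff ?gt_eqF //.
by rewrite gerDl oppr_le0 exprn_ge0 // ltW.
Qed.

Lemma lim_qpoch_gt0 {R : realType} (q u : R) : 0 < q < 1 -> 0 <= u ->
  0 < limn (qpoch q u).
Proof.
move=> q01 u0; rewrite (lt_le_trans ltr01) //; apply: limr_ge.
  exact: qpoch_cvg.
by case/andP: q01 => q0 _; apply: nearW => m; exact: qpoch_ge1.
Qed.

(** For [0 < q < 1], the limit of [lupas_weight q u m k] as [m] grows, before division by the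
    infinite product. *)
Definition lim_lupas_weight {R : realType} (q u : R) (k : nat) : R :=
  q ^+ (k * k.-1)./2 * u ^+ k / ((1 - q) ^+ k * qfact q k).

Lemma lim_lupas_weight_ge0 {R : realType} (q u : R) k : 0 < q < 1 -> 0 <= u ->
  0 <= lim_lupas_weight q u k.
Proof.
move=> /andP[q0 q1] u0; rewrite divr_ge0 ?mulr_ge0 ?exprn_ge0 ?(ltW q0) //.
  by rewrite subr_ge0 ltW.
exact/ltW/qfact_gt0.
Qed.

(** Each of the [k.+1] summands of [qint q k.+1] is at least [q ^+ k]; the bounds are multiplied
    together. *)
Lemma fact_le_qfact {R : realType} (q : R) k : 0 < q < 1 ->
  k`!%:R * q ^+ (k * k.-1)./2 <= qfact q k.
Proof.
move=> /andP[q0 q1]; elim: k => [|k IHk]; first by rewrite qfact0 mulr1.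
rewrite qfactS factS mulnC natrM /= expr_triangular mulrACA.
rewrite ler_pM ?mulr_ge0 ?exprn_ge0 ?(ltW q0) //.
rewrite /qint mulr_natl -[k.+1 in X in X <= _]subn0 -sumr_const_nat.
apply: ler_sum_nat => i /andP[_ ik].
by rewrite ler_wiXn2l // ltW.
Qed.

(* In base [q^-1] the q-integers dominate the integers, so that the weights are
   dominated by the terms of an exponential series. *)
Lemma lim_lupas_weight_le {R : realType} (q u : R) k : 0 < q < 1 -> 0 <= u ->
  lim_lupas_weight q u k <= exp_coeff (u / (1 - q)) k.
Proof.
move=> q01 u0; have /andP[q0 q1] := q01.
have q1' : 0 < 1 - q by rewrite subr_gt0.
rewrite /lim_lupas_weight /exp_coeff /= expr_div_n invfM.
rewrite [leLHS](_ : _ = (u ^+ k / (1 - q) ^+ k) *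
  (q ^+ (k * k.-1)./2 / qfact q k)); last by ring.
apply: ler_wpM2l; first by rewrite divr_ge0 // exprn_ge0 // ltW.
rewrite ler_pdivrMr ?qfact_gt0 // mulrC ler_pdivlMr ?ltr0n ?fact_gt0 //.
by rewrite mulrC fact_le_qfact.
Qed.

Lemma lim_lupas_weightX {R : realType} (q u : R) k : q != 0 ->
  lim_lupas_weight q u k = q ^+ k * lim_lupas_weight q (u / q) k.
Proof.
move=> q0; rewrite /lim_lupas_weight expr_div_n.
have qk : q ^+ k != 0 by rewrite expf_neq0.
rewrite -[u ^+ k in LHS](divfK qk); ring.
Qed.

(** The ratio [rho k] of the two weights is the product of [1 - q ^+ (N - i)] over [i < k], so
    [1 - rho k] is at most a geometric sum, bounded by [q ^+ (N.+1 - k) / (1 - q)]. Replacing [u] by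
    [u / q] absorbs the lost [q ^- k] and keeps the error summable in [k]. *)
Lemma lupas_weight_approx {R : realType} (q u : R) N k : 0 < q < 1 -> 0 <= u ->
  (k <= N)%N ->
  `|lim_lupas_weight q u k - lupas_weight q u N k|
    <= lim_lupas_weight q (u / q) k * (q ^+ N.+1 / (1 - q)).
Proof.
move=> q01 u0 kN; have /andP[q0 q1] := q01.
have q1' : 0 < 1 - q by rewrite subr_gt0.
pose rho i := (1 - q) ^+ i * qfact q N / qfact q (N - i).
have rhoS i : (i < N)%N -> rho i.+1 = rho i * (1 - q ^+ (N - i)).
  move=> iN; rewrite -mul_qint /rho -(subnSK iN) qfactS exprS.
  have /lt0r_neq0 a := qfact_gt0 q (N - i.+1) q0.
  have /lt0r_neq0 b : 0 < qint q (N - i.+1).+1 by exact: qint_gt0.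
  by field; rewrite a b.
have rho_bound : 0 <= rho k <= 1 /\ 1 - rho k <= q ^+ (N.+1 - k) / (1 - q).
  elim: k kN => [_|i IHi iN].
    rewrite /rho subn0 mul1r divff ?ler01 ?lexx ?subrr; last first.
      exact/lt0r_neq0/qfact_gt0.
    by split=> //; rewrite divr_ge0 ?exprn_ge0 ?(ltW q0) ?ltW.
  have [/andP[r0 r1] hr] := IHi (ltnW iN).
  have c0 : 0 <= q ^+ (N - i) by rewrite exprn_ge0 // ltW.
  have c1 : q ^+ (N - i) <= 1 by rewrite exprn_ile1 // ltW.
  rewrite rhoS // subSS; split.
    by rewrite mulr_ge0 ?subr_ge0 //= mulr_ile1 ?subr_ge0 // gerBl.
  (* With [c = q ^+ (N - i)], the old defect contributes at most [q * c] and the new factor at most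
     [(1 - q) * c]; these add up to [c]. *)
  move: hr; rewrite subSn ?(ltnW iN) // exprS !ler_pdivlMr // => hr; nra.
have -> : lupas_weight q u N k = lim_lupas_weight q u k * rho k.
  rewrite /lupas_weight /lim_lupas_weight /qbinom /rho.
  have /lt0r_neq0 a := qfact_gt0 q k q0.
  have /lt0r_neq0 b := qfact_gt0 q (N - k) q0.
  have /lt0r_neq0 c : 0 < (1 - q) ^+ k by rewrite exprn_gt0.
  by field; rewrite a b c.
have [/andP[_ r1] hr] := rho_bound.
have uq : 0 <= u / q by rewrite divr_ge0 // ltW.
rewrite -{1}[lim_lupas_weight q u k]mulr1 -mulrBr normrM.
rewrite ger0_norm ?lim_lupas_weight_ge0 // ger0_norm ?subr_ge0 //.
rewrite lim_lupas_weightX ?gt_eqF // [q ^+ k * _]mulrC -mulrA.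
rewrite ler_wpM2l ?lim_lupas_weight_ge0 // mulrC -(subnK (leqW kN)).
rewrite exprD mulrAC.
by rewrite ler_wpM2r // exprn_ge0 // ltW.
Qed.

Lemma series_exp_coeff_le {R : realType} (x : R) N : 0 <= x ->
  series (exp_coeff x) N <= expR x.
Proof.
move=> x0; apply: nondecreasing_cvgn_le; last exact: is_cvg_series_exp_coeff.
by apply: nondecreasing_series => i _ _; exact: exp_coeff_ge0.
Qed.

(** Numerator and denominator converge separately. The numerator is compared with a partial sum of
    the limit series, with a geometrically small error. *)
Lemma lupas_mean_cvg {R : realType} (q u H : R) (h : nat -> R) :
  0 < q < 1 -> 0 <= u -> (forall k, `|h k| <= H) ->
  lupas_mean q u m h @[m --> \oo] -->
  limn (series (fun k => h k * (lim_lupas_weight q u k / limn (qpoch q u)))).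
Proof.
move=> q01 u0 hH; have /andP[q0 q1] := q01.
have q1' : 0 < 1 - q by rewrite subr_gt0.
have H0 : 0 <= H := le_trans (normr_ge0 _) (hH 0%N).
pose a k := lim_lupas_weight q u k * h k.
have a_cvg : cvgn (series a).
  apply: normed_cvg;
  apply: (series_le_cvg _ (v_ := H *: exp_coeff (u / (1 - q)))).
  - by move=> k; exact: normr_ge0.
  - by move=> k; rewrite /= mulr_ge0 // exp_coeff_ge0 // divr_ge0 // ltW.
  - move=> k; rewrite /= normrM mulrC.
    rewrite (ger0_norm (lim_lupas_weight_ge0 q u k q01 u0)).
    by apply: ler_pM => //; rewrite ?lim_lupas_weight_ge0 ?lim_lupas_weight_le.
  - exact/is_cvg_seriesZ/is_cvg_series_exp_coeff.
have -> : (fun k => h k * (lim_lupas_weight q u k / limn (qpoch q u)))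
    = (limn (qpoch q u))^-1 *: a.
  apply/funext => k; rewrite -[RHS]/((limn (qpoch q u))^-1 * a k) /a.
  by rewrite mulrCA mulrA mulrC.
rewrite lim_seriesZ // /GRing.scale /= mulrC.
apply: cvgM; last first.
  by apply: cvgV; [exact/lt0r_neq0/lim_qpoch_gt0|exact: qpoch_cvg].
(* [H] bounds [h], [1 / (1 - q)] comes from [lupas_weight_approx], and the exponential bounds the
   sum of the limit weights at [u / q]. *)
pose C := H / (1 - q) * expR (u / q / (1 - q)).
have uq : 0 <= u / q by rewrite divr_ge0 // ltW.
have err N : `|series a N.+1
    - \sum_(0 <= k < N.+1) lupas_weight q u N k * h k| <= C * q ^+ N.+1.
  rewrite /series /= -sumrB (le_trans (ler_norm_sum _ _ _)) //.
  apply: (@le_trans _ _ (\sum_(0 <= k < N.+1)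
      exp_coeff (u / q / (1 - q)) k * (H / (1 - q) * q ^+ N.+1))).
    apply: ler_sum_nat => k /andP[_ kN].
    rewrite -mulrBl normrM.
    have wN := lupas_weight_approx q u N k q01 u0 kN.
    rewrite (le_trans (ler_pM _ _ wN (hH k))) //.
    rewrite (_ : _ * H = lim_lupas_weight q (u / q) k *
      (H / (1 - q) * q ^+ N.+1)); last by ring.
    rewrite ler_wpM2r ?lim_lupas_weight_le // mulr_ge0 ?exprn_ge0 ?(ltW q0) //.
    by rewrite divr_ge0 // ltW.
  rewrite -mulr_suml mulrC /C [leRHS]mulrAC ler_wpM2l ?series_exp_coeff_le //.
    by rewrite mulr_ge0 ?divr_ge0 ?exprn_ge0 // ltW.
  by rewrite divr_ge0 // ltW.
have err0 : (fun N => C * q ^+ N.+1) @ \oo --> (0 : R).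
  rewrite -(mulr0 C); apply: cvgMr.
  rewrite (_ : (fun N => _) = (fun N => q ^+ (N + 1))).
    by rewrite cvg_shiftn; apply: cvg_expr; rewrite gtr0_norm.
  by apply/funext => N; rewrite addn1.
have -> : limn (series a) = limn (series a) - 0 by rewrite subr0.
rewrite [X in X @ _ --> _](_ : _ = fun N => series a N.+1 -
  (series a N.+1 - \sum_(0 <= k < N.+1) lupas_weight q u N k * h k)).
  apply: cvgB; first by rewrite (cvg_shiftS (series a)).
  apply: norm_cvg0; apply: (squeeze_cvgr _ (cvg_cst 0) err0).
  by apply: nearW => N; rewrite normr_ge0 err.
by apply/funext => N; rewrite subKr.
Qed.

(** * The modulus of continuity *)

Lemma continuous01_bounded {R : realType} (f : R -> R) :
  {within `[0, 1], continuous f} ->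
  exists M, forall x, 0 <= x <= 1 -> `|f x| <= M.
Proof.
move=> fc.
have := compact_bounded (continuous_compact fc (@segment_compact R 0 1)).
move=> [M [_ HM]]; exists (M + 1) => x x01.
by apply: (HM (M + 1)); [rewrite ltrDl|exists x => //=; rewrite in_itv].
Qed.

(** The real [sup] bounds its set only when the set is bounded above; boundedness of [f] on [[0, 1]]
    supplies this. *)
Lemma modulus_continuity_ub {R : realType} (f : R -> R) (t x y : R) :
  {within `[0, 1], continuous f} -> 0 <= x <= 1 -> 0 <= y <= 1 ->
  `|x - y| <= t -> `|f x - f y| <= modulus_continuity f t.
Proof.
move=> /continuous01_bounded[M fM] x01 y01 xyt.
apply: ub_le_sup; last by exists x, y.
exists (M + M) => _ [a [b [a01 b01 _ ->]]].
by rewrite (le_trans (ler_normB _ _)) // lerD ?fM.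
Qed.

Lemma modulus_continuity_ge0 {R : realType} (f : R -> R) (t : R) :
  {within `[0, 1], continuous f} -> 0 <= t -> 0 <= modulus_continuity f t.
Proof.
move=> fc t0; have := @modulus_continuity_ub R f t 0 0 fc.
by rewrite !subrr normr0; apply; rewrite ?lexx ?ler01.
Qed.

(** Going from [y] down to [x] by steps of length at most [t] stays in [[0, 1]] and costs at most
    one modulus per step. *)
Lemma modulus_continuity_affine {R : realType} (f : R -> R) (t x y : R) :
  {within `[0, 1], continuous f} -> 0 < t -> 0 <= x -> x <= y -> y <= 1 ->
  `|f x - f y| <= (1 + (y - x) / t) * modulus_continuity f t.
Proof.
move=> fc t0 x0 xy y1; set w := modulus_continuity f t.
have w0 : 0 <= w := modulus_continuity_ge0 f t fc (ltW t0).
have step m : forall z, x <= z -> z <= 1 -> z - x <= m.+1%:R * t ->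
    `|f x - f z| <= m.+1%:R * w.
  elim: m => [|m IHm] z xz z1 zxt.
    rewrite mul1r modulus_continuity_ub //; first by rewrite x0 (le_trans xz).
      by rewrite (le_trans x0).
    by rewrite distrC ger0_norm ?subr_ge0 // -[t]mul1r.
  have [zt|tz] := leP (z - x) t.
    rewrite (@le_trans _ _ w) //; last by rewrite ler_peMl // ler1n.
    rewrite modulus_continuity_ub //; first by rewrite x0 (le_trans xz).
      by rewrite (le_trans x0).
    by rewrite distrC ger0_norm ?subr_ge0.
  rewrite -(subrKA (f (z - t))) (le_trans (ler_normD _ _)) //.
  rewrite [m.+2%:R]mulrS mulrDl mul1r addrC lerD //.
    rewrite modulus_continuity_ub //.
    - by apply/andP; split; lra.
    - by apply/andP; split; lra.
    - by rewrite addrAC subrr add0r normrN gtr0_norm.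
  apply: IHm; [lra|lra|].
  by move: zxt; rewrite [m.+2%:R]mulrS mulrDl mul1r; lra.
have d0 : 0 <= (y - x) / t by rewrite divr_ge0 ?subr_ge0 // ltW.
(* One step more than the integer part of [(y - x) / t] suffices. *)
apply: (le_trans (step (Num.truncn ((y - x) / t)) y xy y1 _)).
  by rewrite -ler_pdivrMr // ltW // truncnS_gt.
by rewrite ler_wpM2r // mulrS lerD2l truncn_le.
Qed.

(** * The operator as a mean, and the final estimate *)

Lemma lupas_basisE {R : realType} (q x : R) n k : 0 < q -> 0 <= x < 1 ->
  (0 < n)%N -> (k <= n)%N -> lupas_basis q n k x =
  lupas_weight q (x / (1 - x)) n k / qpoch q (x / (1 - x)) n.
Proof.
move=> q0 /andP[x0 x1]; case: n => // n _ kn.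
have x1' : 0 < 1 - x by rewrite subr_gt0.
have u0 : 0 <= x / (1 - x) by rewrite divr_ge0 // ltW.
have qpochE : (1 - x) ^+ n.+1 * qpoch q (x / (1 - x)) n.+1
    = \prod_(1 <= j < n.+1) (1 - x + q ^+ j * x).
  (* The factor of index [0] is [1 + x / (1 - x) = 1 / (1 - x)] and cancels one power of [1 - x];
     the other powers clear the denominators of the remaining factors. *)
  rewrite /qpoch big_ltn // expr0 mul1r exprS mulrACA.
  rewrite mulrDr mulr1 mulrC [_ * (x / _)]mulrC divfK ?gt_eqF // subrK mulr1.
  elim: n {kn} => [|m IHm]; first by rewrite !big_geq // mulr1.
  rewrite !(big_nat_recr m.+1) //= exprSr mulrACA IHm; congr (_ * _).
  by field; rewrite gt_eqF.
rewrite /lupas_basis -qpochE /lupas_weight expr_div_n.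
rewrite -[X in _ / (_ ^+ X * _)](subnK kn) exprD.
have /lt0r_neq0 a : 0 < (1 - x) ^+ (n.+1 - k) by rewrite exprn_gt0.
have /lt0r_neq0 b : 0 < (1 - x) ^+ k by rewrite exprn_gt0.
have /lt0r_neq0 c := qpoch_gt0 q (x / (1 - x)) n.+1 q0 u0.
by field; rewrite a b c.
Qed.

(** The difference equals [q ^+ n * (1 - q ^+ k) / (1 - q ^+ n)], whose quotient is at most 1
    because [k <= n]. *)
Lemma norm_qint_div_sub {R : realType} (q : R) n k : 0 < q < 1 -> (0 < n)%N ->
  (k <= n)%N -> `|qint q k / qint q n - (1 - q ^+ k)| <= q ^+ n.
Proof.
move=> /andP[q0 q1] n0 kn.
have qn : q ^+ n < 1 by rewrite exprn_ilt1 // ?ltW // -lt0n.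
have qnk : q ^+ n <= q ^+ k by rewrite ler_wiXn2l // ltW.
have qk1 : q ^+ k <= 1 by rewrite exprn_ile1 // ltW.
have q1' : 1 - q != 0 by rewrite subr_eq0 gt_eqF.
have -> : qint q k / qint q n = (1 - q ^+ k) / (1 - q ^+ n).
  by rewrite -!mul_qint -mulf_div divff // mul1r.
have qn1 : 0 < 1 - q ^+ n by rewrite subr_gt0.
have -> : (1 - q ^+ k) / (1 - q ^+ n) - (1 - q ^+ k)
    = (1 - q ^+ k) / (1 - q ^+ n) * q ^+ n by field; rewrite gt_eqF.
have qn0 : 0 <= q ^+ n by rewrite exprn_ge0 // ltW.
rewrite ger0_norm; last by rewrite mulr_ge0 // divr_ge0 ?subr_ge0 // ltW.
by rewrite ler_piMl // ler_pdivrMr // mul1r lerD2l lerN2.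
Qed.

Theorem theorem11 (R : realType) (q : R) (f : R -> R) (n : nat) :
  0 < q < 1 -> {within `[0, 1], continuous f} -> (1 <= n)%N ->
  forall x : R, 0 <= x < 1 ->
    `|lupas q n f x - lim_lupas q f x|
      <= 2 / (1 - q) * (1 / (1 - x)) * modulus_continuity f (q ^+ n).
Proof.
move=> q01 fc n0 x x01; have /andP[q0 q1] := q01; have /andP[x0 x1] := x01.
set w := modulus_continuity f (q ^+ n); set u := x / (1 - x).
have x1' : 0 < 1 - x by rewrite subr_gt0.
have u0 : 0 <= u by rewrite divr_ge0 // ltW.
have qn0 : 0 < q ^+ n by rewrite exprn_gt0.
have w0 : 0 <= w := modulus_continuity_ge0 f _ fc (ltW qn0).
have qX01 k : 0 <= 1 - q ^+ k <= 1.
  by rewrite subr_ge0 gerBl exprn_ile1 ?exprn_ge0 // ltW.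
pose g k := f (1 - q ^+ k).
have lupas_near : `|lupas q n f x - lupas_mean q u n g| <= w.
  have -> : lupas q n f x = lupas_mean q u n (fun k => f (qint q k / qint q n)).
    rewrite /lupas /lupas_mean mulr_suml; apply: eq_big_nat => k /andP[_ kn].
    by rewrite lupas_basisE // mulrC mulrAC.
  rewrite -lupas_meanB -[w](lupas_mean_cst q u n) //.
  apply: ler_norm_lupas_mean => // k kn.
  apply: modulus_continuity_ub => //; last exact: norm_qint_div_sub.
  rewrite divr_ge0 ?qint_ge0 ?(ltW q0) //= ler_pdivrMr ?qint_gt0 // mul1r.
  by rewrite -(subnKC kn) qintD lerDl mulr_ge0 ?exprn_ge0 ?qint_ge0 ?(ltW q0).
have mean_near j :
    `|lupas_mean q u n g - lupas_mean q u (n + j) g| <= w * (1 + x).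
  (* For [k <= l] the nodes are [q ^+ k - q ^+ l] apart, so the affine bound with [t = q ^+ n] has
     exactly the form [c + d k - e l]. *)
  have := lupas_mean_coupling q u n j g g (fun k => w / q ^+ n * q ^+ k)
    (fun k => w / q ^+ n * q ^+ k) w q0 u0.
  rewrite !lupas_meanZ !lupas_mean_expr // => /(_ _)/le_trans; apply.
    move=> k l kl.
    apply: le_trans (modulus_continuity_affine f (q ^+ n) _ _ fc _ _ _ _) _ => //.
    - by case/andP: (qX01 k).
    - by rewrite lerD2l lerN2 ler_wiXn2l // ltW.
    - by case/andP: (qX01 l).
    - by rewrite -/w le_eqVlt; apply/orP; left; apply/eqP; field; rewrite gt_eqF.
  (* Here [u / (1 + u) = x] is used. *)
  rewrite (_ : _ - _ = w * (1 + (1 - q ^+ j) * x)); last first.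
    rewrite exprD /u; field.
    by rewrite subrK oner_eq0 !gt_eqF.
  by rewrite ler_wpM2l // lerD2l ler_piMl // gerBl exprn_ge0 // ltW.
have [M fM] := continuous01_bounded f fc.
have := lupas_mean_cvg q u M g q01 u0 (fun k => fM _ (qX01 k)).
set L := limn _ => gL.
have -> : lim_lupas q f x = L.
  rewrite /lim_lupas lt_eqF //; congr (limn (series _)).
  apply/funext => k; rewrite /lim_lupas_basis -/u invfM; congr (_ * _).
  by rewrite mulrA.
have gL_near : `|lupas_mean q u n g - L| <= w * (1 + x).
  have cvg_dist : `|lupas_mean q u n g - lupas_mean q u m g| @[m --> \oo]
      --> `|lupas_mean q u n g - L|.
    by apply: cvg_norm; apply: cvgB => //; exact: cvg_cst.
  (* The bound of [mean_near] is uniform in [j], so it passes to the limit. *)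
  rewrite -(cvg_lim _ cvg_dist) //; apply: limr_le.
    by apply/cvg_ex; eexists; exact: cvg_dist.
  by exists n => // m /= nm; rewrite -(subnKC nm).
rewrite -(subrKA (lupas_mean q u n g)) (le_trans (ler_normD _ _)) //.
rewrite (le_trans (lerD lupas_near gL_near)) //.
rewrite (_ : w + w * (1 + x) = (2 + x) * w); last by ring.
rewrite ler_wpM2r // mulf_div mulr1 ler_pdivlMr ?mulr_gt0 ?subr_gt0 //.
(* [(2 + x) * (1 - x) = 2 - x - x ^+ 2] is at most 2, and [0 < 1 - q <= 1]. *)
nra.
Qed.
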